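(* For Lebesgue almost every $x\in K$, there exist a finite sequence $(i_n)_{n=1}^N\in\{1,\ldots,m\}^N$ and some $k\in\{1,\ldots,s\}$ such that $T_{i_1\ldots i_N}(x)$ is in the interior of $H_k$.
   Context: Let $f_j(x)=r_jx+d_j$, $1\le j\le m$, with $0<r_j<1$ and $d_j\in\mathbb{R}$, be an iterated function system on $\mathbb{R}$, and let $K$ be its attractor, i.e. the unique non-empty compact set with $K=\bigcup_{j=1}^m f_j(K)$. Assume $K=[a,b]$ is a (nondegenerate) interval. Put $T_j=f_j^{-1}$ and $T_{i_1\ldots i_n}=T_{i_n}\circ\cdots\circ T_{i_1}$, and $I_j=f_j(K)$. Let $H_1,\ldots,H_s$ ($s\geq 1$) be the non-empty intersections $I_i\cap I_j$ with $i\ne j$. It is assumed that each $H_k=[a_k,b_k]$ is a nontrivial interval contained in the interior of $K$, and that the $H_k$ are pairwise disjoint and listed from left to right. *)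

(* Defs.v *)
From HB Require Import structures.
From mathcomp Require Import all_boot all_order all_algebra.
From mathcomp Require Import all_classical all_reals all_analysis.
Set Implicit Arguments.
Unset Strict Implicit.
Unset Printing Implicit Defensive.
Import Order.TTheory GRing.Theory Num.Theory.
Import numFieldNormedType.Exports.
Local Open Scope classical_set_scope.
Local Open Scope ring_scope.

Definition ifs_map (R : realType) (m : nat) (r d : 'I_m -> R) (j : 'I_m)
  (x : R) : R := r j * x + d j.

Definition ifs_inv (R : realType) (m : nat) (r d : 'I_m -> R) (j : 'I_m)
  (x : R) : R := (x - d j) / r j.

Lemma ifs_mapK (R : realType) (m : nat) (r d : 'I_m -> R) (j : 'I_m) :
  r j != 0 -> cancel (ifs_map r d j) (ifs_inv r d j).
Proof. by move=> rj0 x; rewrite /ifs_inv /ifs_map addrK mulrC mulKf. Qed.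

Lemma ifs_invK (R : realType) (m : nat) (r d : 'I_m -> R) (j : 'I_m) :
  r j != 0 -> cancel (ifs_inv r d j) (ifs_map r d j).
Proof. by move=> rj0 x; rewrite /ifs_inv /ifs_map mulrC divfK // subrK. Qed.

(* T_{i_1 ... i_n} = T_{i_n} \o ... \o T_{i_1}: the first letter of the word
   acts first. *)
Definition ifs_inv_word (R : realType) (m : nat) (r d : 'I_m -> R)
  (w : seq 'I_m) (x : R) : R := foldl (fun y j => ifs_inv r d j y) x w.

(* When 0 < r j < 1 for all j, Hutchinson's theorem says that at most one set
   satisfies these conditions, so uniqueness is not part of the definition. *)
Definition is_attractor (R : realType) (m : nat) (r d : 'I_m -> R)
  (K : set R) : Prop :=
  [/\ K !=set0, compact K & K = \bigcup_(j in [set: 'I_m]) (ifs_map r d j @` K)].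

(* The non-empty intersections of I_i and I_j, i != j, as a collection of sets:
   different pairs {i, j} may give the same member. *)
Definition ifs_overlaps (R : realType) (m : nat) (r d : 'I_m -> R)
  (K : set R) : set (set R) :=
  [set A | A !=set0 /\ exists i j : 'I_m,
     i != j /\ A = (ifs_map r d i @` K) `&` (ifs_map r d j @` K)].

(* Main.v *)
Require Import Defs.
From HB Require Import structures.
From mathcomp Require Import all_boot all_order all_algebra.
From mathcomp Require Import all_classical all_reals all_analysis.
From mathcomp Require Import lra.
Set Implicit Arguments.
Unset Strict Implicit.
Unset Printing Implicit Defensive.
Import Order.TTheory GRing.Theory Num.Theory.
Import numFieldNormedType.Exports.
Local Open Scope classical_set_scope.
Local Open Scope ring_scope.

(** The set of exceptional points is porous, hence Lebesgue null. Fix one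
    overlap [al, be] and a point x of K = [a, b]. Since K is the union of its
    images f_j(K), some branch of inverse maps can be followed from x for ever
    inside K: for every n there is a word w of length n with T_w x in K, that
    is, x lies in the cylinder f_w(K), of length rho_w (b - a), where rho_w is
    the product of the ratios along w ([attractor_word]). This cylinder
    contains f_w(]al, be[), and all the points of that copy are good, because
    T_w sends them into the interior of the overlap. The copy has length
    rho_w (be - al), a fixed proportion of the length of the cylinder, and the
    cylinder shrinks to x as n grows ([word_ratio_lt]).

    So at every exceptional x there are arbitrarily small balls in which the
    exceptional set misses an interval of a fixed proportion. Its density at x
    therefore cannot be 1, and Lebesgue's density theorem concludes
    ([porous_ae]). The argument uses any word that keeps the orbit of x in K,
    so the ambiguity of the coding on the overlaps does no harm. *)

(** At almost every point of A the density of A is 1, whereas a hole of length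
    c * e in a ball of radius e bounds the relative measure of A in that ball
    by 1 - c / 2. *)
Lemma porous_ae (R : realType) (A : set R) (c : R) :
  measurable A -> 0 < c ->
  (forall x, A x -> forall eps, 0 < eps -> exists e u v : R,
    [/\ 0 < e < eps, c * e <= v - u, `]u, v[ `<=` ball x e &
        `]u, v[ `&` A = set0]) ->
  {ae @lebesgue_measure R, forall x, ~ A x}.
Proof.
move=> mA c0 porA; have := lebesgue_density mA.
apply: filterS; first exact: (ae_filter_ringOfSetsType lebesgue_measure).
move=> x.
move=> + Ax; rewrite indicE mem_set//= => /(_ [set y | ((1 - c / 2)%:E < y)%E]).
have n1 : nbhs (1%:E : \bar R) [set y | ((1 - c / 2)%:E < y)%E].
  by apply: open_nbhs_nbhs; split; [exact: open_ereal_gt_ereal|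
    rewrite /= lte_fin; lra].
move=> /(_ n1) /nbhs_right0P /= [eps /= eps0 hd].
have [e [u [v [/andP[e0 ltee] ce sub dis]]]] := porA x Ax eps eps0.
have := hd e; rewrite /= sub0r normrN gtr0_norm// => /(_ ltee e0).
rewrite add0r lebesgue_measure_ball ?ltW//.
have mI : measurable (`]u, v[%classic : set R) by exact: measurable_itv.
have mB : measurable (ball x e) by rewrite ball_itv; exact: measurable_itv.
have uv : u < v by rewrite -subr_gt0 (lt_le_trans _ ce)// mulr_gt0.
have muI : (@lebesgue_measure R `]u, v[ = (v - u)%:E)%E.
  by rewrite lebesgue_measure_itv/= lte_fin uv EFinB.
have muB : (lebesgue_measure (A `&` ball x e) + (v - u)%:E <= (e *+ 2)%:E)%E.
  rewrite -muI -measureU//; last 2 first.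
  - exact: measurableI.
  - by rewrite setIAC [A `&` _]setIC dis set0I.
  rewrite -(lebesgue_measure_ball x (ltW e0)) le_measure ?inE//.
  - by apply: measurableU => //; exact: measurableI.
  - by rewrite subUset; split.
move: muB; have : (0 <= lebesgue_measure (A `&` ball x e))%E by [].
case: (lebesgue_measure _) => [z| |]//=.
rewrite -EFinD !lee_fin => z0 zle.
rewrite inver mulrn_eq0/= gt_eqF// -EFinM lte_fin ltr_pdivlMr ?mulrn_wgt0//.
nra.
Qed.

Section Words.
Context (R : realType) (m : nat) (r d : 'I_m -> R).
Hypothesis r01 : forall j, 0 < r j < 1.

Definition word_ratio (w : seq 'I_m) : R := \prod_(j <- w) r j.

Let r_neq0 j : r j != 0. Proof. by have /andP[/gt_eqF->] := r01 j. Qed.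

Lemma word_ratio_gt0 w : 0 < word_ratio w.
Proof. by apply: prodr_gt0 => j _; have /andP[] := r01 j. Qed.

(** Comparing the orbit of y with that of a point x whose orbit is known to
    stay in K spares any formula for the constant term. *)
Lemma ifs_inv_word_affine w x y :
  ifs_inv_word r d w y = ifs_inv_word r d w x + (y - x) / word_ratio w.
Proof.
rewrite /ifs_inv_word /word_ratio.
elim: w x y => [|j w IH] x y /=; first by rewrite big_nil divr1 addrC subrK.
rewrite big_cons (IH (ifs_inv r d j x)); congr (_ + _).
by rewrite /ifs_inv -mulrBl opprB addrA subrK invfM mulrA.
Qed.

Lemma open_preimage_ifs_inv_word w (U : set R) :
  open U -> open (ifs_inv_word r d w @^-1` U).
Proof.
move=> oU; apply: open_comp => // x _.
under [ifs_inv_word r d w]funext do rewrite (ifs_inv_word_affine w 0) subr0.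
apply: cvgD; first exact: cvg_cst.
by apply: cvgMl; exact: cvg_id.
Qed.

(** With finitely many ratios, all below 1, long words contract uniformly. *)
Lemma word_ratio_lt (eps : R) : 0 < eps ->
  exists n, forall w, size w = n.+1 -> word_ratio w < eps.
Proof.
move=> eps0; pose q := \big[Num.max/0]_j r j.
have q0 : 0 <= q by exact: bigmax_ge_id.
have q1 : q < 1.
  by apply/bigmax_ltP; split => // j _; have /andP[] := r01 j.
have ratio_le w : word_ratio w <= q ^+ size w.
  rewrite /word_ratio; elim: w => [|j w IH]; first by rewrite big_nil.
  rewrite big_cons exprS ler_pM//.
  - by have /andP[/ltW] := r01 j.
  - exact/ltW/word_ratio_gt0.
  - exact: le_bigmax.
have /cvgr0Pnorm_lt/(_ _ eps0)[n _ hn] : q ^+ n @[n --> \oo] --> 0.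
  by apply: cvg_expr; rewrite ger0_norm.
exists n => w sw; apply: (le_lt_trans (ratio_le w)).
by rewrite sw (le_lt_trans (ler_norm _))//; apply: hn => /=.
Qed.

(** Each point of K is f_j(y) for some j and some y in K, and then applying
    T_j leads to y: the orbit never has to leave K. *)
Lemma attractor_word (K : set R) n x : is_attractor r d K -> K x ->
  exists2 w, size w = n & K (ifs_inv_word r d w x).
Proof.
move=> [_ _ KE]; elim: n x => [|n IH] x Kx; first by exists [::].
move: Kx; rewrite {1}KE => -[j _ [y Ky <-]].
by have [w sw Kw] := IH y Ky; exists (j :: w); rewrite /= ?sw ?ifs_mapK.
Qed.

End Words.

Theorem corollary3p1 (R : realType) (m : nat) (r d : 'I_m -> R)
  (hr : forall j : 'I_m, 0 < r j < 1)
  (K : set R) (hK : is_attractor r d K)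
  (a b : R) (hab : a < b) (hKab : K = `[a, b]%classic)
  (s : nat) (hs : (0 < s)%N)
  (H : 'I_s -> set R) (hH : range H = ifs_overlaps r d K)
  (al be : 'I_s -> R) (hHab : forall k : 'I_s, H k = `[al k, be k]%classic)
  (hnontriv : forall k : 'I_s, al k < be k)
  (hint : forall k : 'I_s, H k `<=` interior K)
  (hdisj : trivIset [set: 'I_s] H)
  (hord : forall k l : 'I_s, (k < l)%N -> al k < al l) :
  {ae @lebesgue_measure R, forall x : R, K x ->
    exists (N : nat) (w : N.-tuple 'I_m) (k : 'I_s),
      (0 < N)%N /\ interior (H k) (ifs_inv_word r d w x)}.
Proof.
pose k := Ordinal hs.
have lt_ab := hnontriv k.
pose good := \bigcup_(w in [set w : seq 'I_m | (0 < size w)%N])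
  (ifs_inv_word r d w @^-1` `]al k, be k[).
have ogood : open good.
  by apply: bigcup_open => w _; apply: open_preimage_ifs_inv_word => //;
    exact: itv_open.
have HK y : al k < y < be k -> a <= y <= b.
  move=> /andP[ay yb]; suff : K y by rewrite hKab /= in_itv.
  by apply: interior_subset; apply: (hint k); rewrite hHab /= in_itv/= !ltW.
suff : {ae @lebesgue_measure R, forall x, ~ (K `\` good) x}.
  apply: filterS; first exact: (ae_filter_ringOfSetsType lebesgue_measure).
  move=> x nKx Kx.
  have [w w0 Tx] : good x by apply: contrapT => ngood; exact: nKx.
  exists (size w), (in_tuple w), k; split=> //.
  suff : `]al k, be k[%classic `<=` interior (H k) by exact.
  rewrite -open_subsetE; last exact: itv_open.
  by rewrite hHab; exact: subset_itv_oo_cc.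
have ba0 : 0 < b - a by rewrite subr_gt0.
(* The ball around x below has radius 2 (b - a) rho_w, twice the length of the
   cylinder of w, and its hole has length (be k - al k) rho_w. *)
apply: (@porous_ae _ _ ((be k - al k) / (2 * (b - a)))).
- apply: measurableD; first by rewrite hKab; exact: measurable_itv.
  exact: measurable_realfun.open_measurable.
- by rewrite divr_gt0 ?subr_gt0// mulr_gt0.
move=> x [Kx ngood] eps eps0.
have [n hn] := word_ratio_lt hr (divr_gt0 eps0 (mulr_gt0 (ltr0Sn R 1) ba0)).
have [w sw] := attractor_word hr n.+1 hK Kx.
rewrite hKab /= in_itv/= => /andP[aT Tb].
have rho0 := word_ratio_gt0 hr w; have := hn w sw.
set rho := word_ratio r w in rho0 *; set Tx := ifs_inv_word r d w x in aT Tb.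
rewrite ltr_pdivlMr ?mulr_gt0// => rho_lt.
have hole y : x + rho * (al k - Tx) < y < x + rho * (be k - Tx) ->
    al k < ifs_inv_word r d w y < be k.
  rewrite (ifs_inv_word_affine _ _ w x) -/Tx -/rho; set t := (y - x) / rho.
  have -> : y = x + rho * t by rewrite mulrC divfK ?gt_eqF// addrC subrK.
  by rewrite !ltrD2l !ltr_pM2l//; lra.
exists (rho * (2 * (b - a))), (x + rho * (al k - Tx)), (x + rho * (be k - Tx)).
split.
- by rewrite rho_lt !mulr_gt0.
- rewrite mulrCA divfK ?gt_eqF ?mulr_gt0//; lra.
- move=> y; rewrite /= in_itv/= => /[dup] /hole /HK /andP[aTy Tyb] _.
  rewrite /ball/= -normrN opprB.
  move: aTy Tyb; rewrite (ifs_inv_word_affine _ _ w x) -/Tx -/rho => aTy Tyb.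
  have -> : y - x = rho * ((y - x) / rho) by rewrite mulrC divfK ?gt_eqF.
  rewrite normrM gtr0_norm// ltr_pM2l// ltr_norml; lra.
- apply/seteqP; split=> // y [/=]; rewrite in_itv/= => /hole Hy [_]; apply.
  by exists w; rewrite /= ?sw// in_itv.
Qed.
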